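(* Let $\Lambda=\{1,\ldots,N_s\}$ with $N_s$ even and periodic boundary conditions ($N_s+x$ identified with $x$), $t>0$, $t'>0$, and $$H=-t\sum_{x=1}^{N_s}\sum_{\sigma}(c^\dagger_{x,\sigma}c_{x+1,\sigma}+c^\dagger_{x+1,\sigma}c_{x,\sigma})+t'\sum_{j=1}^{N_s/2}\sum_{\sigma}(c^\dagger_{2j,\sigma}c_{2j+2,\sigma}n_{2j+1}+c^\dagger_{2j+2,\sigma}c_{2j,\sigma}n_{2j+1})+U\sum_{x=1}^{N_s}n_{x,\uparrow}n_{x,\downarrow}.$$ In the limit $U=\infty$ and for any odd electron number $N_e$ (necessarily $N_e<N_s$), the ground states have total spin $S_{\rm tot}=S_{\max}=N_e/2$ and are nondegenerate apart from the trivial $(2S_{\max}+1)$-fold degeneracy.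
   Context: $c_{x,\sigma}$ are fermion annihilation operators ($x\in\Lambda$, $\sigma\in\{\uparrow,\downarrow\}$) with canonical anticommutation relations and vacuum $\Phi_{\rm vac}$; $\mathcal H_{N_e}$ is the span of $c^\dagger_{x_1,\sigma_1}\cdots c^\dagger_{x_{N_e},\sigma_{N_e}}\Phi_{\rm vac}$; $n_{x,\sigma}=c^\dagger_{x,\sigma}c_{x,\sigma}$, $n_x=n_{x,\uparrow}+n_{x,\downarrow}$. The $U=\infty$ limit means: with $P_0=\prod_x(1-n_{x,\uparrow}n_{x,\downarrow})$, one studies $P_0H'P_0$ on $P_0\mathcal H_{N_e}$, where $H'$ is $H$ without the $U$ term; ground states are its lowest-eigenvalue eigenvectors. Total spin operators $S^{(\alpha)}_{\rm tot}=\frac12\sum_x\sum_{\sigma,\tau}c^\dagger_{x,\sigma}(p^{(\alpha)})_{\sigma,\tau}c_{x,\tau}$ (Pauli matrices); total spin $S_{\rm tot}$ means $\sum_\alpha(S^{(\alpha)}_{\rm tot})^2=S_{\rm tot}(S_{\rm tot}+1)$ on the state. ''Nondegenerate apart from the trivial $(2S_{\max}+1)$-fold degeneracy'' means the ground-state eigenspace has dimension exactly $2S_{\max}+1$ and all ground states have $S_{\rm tot}=S_{\max}$. *)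

(* Defs.v *)
From HB Require Import structures.
From mathcomp Require Import all_boot all_order all_algebra.
From mathcomp Require Import reals.
From mathcomp Require Import complex.
Set Implicit Arguments. Unset Strict Implicit. Unset Printing Implicit Defensive.
Import Order.TTheory GRing.Theory Num.Theory.
Local Open Scope ring_scope.

Section Fock.
Variable R : realType.
Local Notation C := R[i].
Variable Ns : nat.

(* Sites 1..Ns, periodic: site label x (any nat) is the class x mod Ns.
   The site type is 'I_Ns.-1.+1, which has Ns elements whenever Ns > 0. *)
Definition site := 'I_Ns.-1.+1.
Definition st (x : nat) : site := inord (x %% Ns).

(* Spin: true = up, false = down. A mode is a pair (site, spin). *)
Definition mode := (site * bool)%type.

(* Fock space: complex functions on occupation sets (subsets of modes);
   the basis vector of S is c^dag_{m1} ... c^dag_{mk} Phi_vac for the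
   modes of S listed in the fixed order given by enum_rank. *)
Definition vec := {ffun {set mode} -> C}.
Definition op := vec -> vec.

Definition jw (m : mode) (S : {set mode}) : C :=
  (-1) ^+ #|[set m' in S | (val (enum_rank m') < val (enum_rank m))%N]|.

Definition c (m : mode) : op := fun v =>
  [ffun S : {set mode} => if m \in S then 0 else jw m S * v (m |: S)].
Definition cd (m : mode) : op := fun v =>
  [ffun S : {set mode} => if m \in S then jw m S * v (S :\ m) else 0].

Definition nop (m : mode) : op := fun v => cd m (c m v).
Definition nsite (x : site) : op := fun v => nop (x, true) v + nop (x, false) v.

Definition Hprime (t t' : C) : op := fun v =>
  - t *: \sum_(1 <= x < Ns.+1) \sum_(s : bool)
       (cd (st x, s) (c (st x.+1, s) v) + cd (st x.+1, s) (c (st x, s) v))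
  + t' *: \sum_(1 <= j < (Ns./2).+1) \sum_(s : bool)
       (cd (st j.*2, s) (c (st j.*2.+2, s) (nsite (st j.*2.+1) v))
        + cd (st j.*2.+2, s) (c (st j.*2, s) (nsite (st j.*2.+1) v))).

Definition P0 : op := fun v =>
  foldr (fun x w => w - nop (x, true) (nop (x, false) w)) v (enum site).

Definition inH (Ne : nat) (v : vec) : Prop :=
  forall S : {set mode}, #|S| != Ne -> v S = 0.

Definition inDom (Ne : nat) (w : vec) : Prop := exists v, inH Ne v /\ w = P0 v.

(* the U = infinity effective Hamiltonian P_0 H' P_0 *)
Definition Heff (t t' : C) : op := fun v => P0 (Hprime t t' (P0 v)).

Definition is_eigenvalue (t t' : C) (Ne : nat) (E : C) : Prop :=
  exists w, [/\ inDom Ne w, w != 0 & Heff t t' w = E *: w].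

Definition is_ground_energy (t t' : C) (Ne : nat) (E0 : C) : Prop :=
  is_eigenvalue t t' Ne E0 /\ forall E, is_eigenvalue t t' Ne E -> E0 <= E.

Definition ground_space (t t' : C) (Ne : nat) (E0 : C) (w : vec) : Prop :=
  inDom Ne w /\ Heff t t' w = E0 *: w.

Definition pauli (a : 'I_3) (s u : bool) : C :=
  match val a with
  | 0 => if s != u then 1 else 0
  | 1 => if s == u then 0 else if s then - 'i else 'i
  | _ => if s == u then (if s then 1 else -1) else 0
  end.

Definition Stot (a : 'I_3) : op := fun v =>
  2^-1 *: \sum_(x : site) \sum_(s : bool) \sum_(u : bool)
     pauli a s u *: cd (x, s) (c (x, u) v).

Definition Stot2 : op := fun v => \sum_(a : 'I_3) Stot a (Stot a v).

Definition has_total_spin (Sv : C) (w : vec) : Prop :=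
  Stot2 w = (Sv * (Sv + 1)) *: w.

Definition has_dim (P : vec -> Prop) (d : nat) : Prop :=
  exists b : 'I_d -> vec,
    [/\ forall i, P (b i),
        forall a : 'I_d -> C, \sum_i a i *: b i = 0 -> forall i, a i = 0
      & forall w, P w -> exists a : 'I_d -> C, w = \sum_i a i *: b i].

End Fock.

Arguments has_total_spin {R} Ns Sv w.
Arguments ground_space {R} Ns t t' Ne E0 w.
Arguments has_dim {R} Ns P d.
Arguments inDom {R} Ns Ne w.
Arguments inH {R} Ns Ne v.

(* Main.v *)
(** In the site-ordered occupation basis of the states without double occupancy,
every hop of the effective Hamiltonian exchanges an electron with a hole.  With
an odd number of electrons a nearest-neighbour hop has amplitude -t, also across
the boundary, where the mover passes an even number of electrons; a correlated
hop has amplitude -t', since the electron jumped over contributes a sign.  Which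
hops are allowed depends only on the set of occupied sites, so a
Perron-Frobenius vector on these sets, read as a function G of configurations
that ignores the spins, is a positive eigenvector.  For an eigenvector w = u G
the energy excess times the squared norm is a sum of squares of differences of u
along the hops, so G has the lowest energy and the ground states are the w = u G
with u constant on the connected components of the hopping graph.  These are the
sectors of fixed number of up spins: nearest-neighbour hops rotate the cyclic
word of spins and a correlated hop exchanges two neighbours in it.  Hence there
are Ne + 1 independent ground states, and they carry the spin-Ne/2
representation. *)

Require Import Defs.
From HB Require Import structures.
From mathcomp Require Import all_boot all_order all_algebra all_fingroup.
From mathcomp Require Import reals.
From mathcomp Require Import complex.
From mathcomp Require Import ring zify.
Set Implicit Arguments. Unset Strict Implicit. Unset Printing Implicit Defensive.
Import Order.TTheory GRing.Theory Num.Theory.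
Local Open Scope ring_scope.

(** * Positive eigenvectors *)

Section Perron.
Variable C : numClosedFieldType.
Local Open Scope sesquilinear_scope.

Lemma mulmx_trC_diag n (x : 'rV[C]_n) (d : 'rV[C]_n) :
  (x *m diag_mx d *m x^t*) 0 0 = \sum_k d 0 k * `|x 0 k| ^+ 2.
Proof.
rewrite mxE; apply: eq_bigr => k _.
by rewrite mul_mx_diag !mxE normCK; ring.
Qed.

Lemma mulmx_trC_norm n (x : 'rV[C]_n) : (x *m x^t*) 0 0 = \sum_k `|x 0 k| ^+ 2.
Proof. by rewrite mxE; apply: eq_bigr => k _; rewrite !mxE normCK. Qed.

(** Variational argument: replacing a top eigenvector by its entrywise absolute values keeps the
    norm and cannot lower the quadratic form of a nonnegative matrix, so the new vector is again a
    maximizer and hence an eigenvector. *)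
Lemma symmetric_nonneg_eigenvector n (A : 'M[C]_n) (i0 : 'I_n) :
  A^T = A -> (forall i j, 0 <= A i j) ->
  exists lam : C, exists v : 'rV[C]_n,
    [/\ forall i, 0 <= v 0 i, v != 0 & v *m A = lam *: v].
Proof.
move=> symA A_ge0.
have hA : A \is hermsymmx.
  apply: realsym_hermsym; last by apply/mxOverP => i j; apply: ger0_real.
  by apply/is_hermitianmxP; rewrite expr0 scale1r map_mx_id // symA.
have dreal := hermitian_spectral_diag_real hA.
have /hermitian_normalmx /orthomx_spectralP := hA.
set P := spectralmx A; set d := spectral_diag A in dreal *.
have PU : P \is unitarymx := spectral_unitarymx A.
rewrite invmx_unitary // => eA.
have PPt : P *m P^t* = 1%:M by apply/unitarymxP.
have PtP : P^t* *m P = 1%:M by apply: mulmx1C.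
have dR k : d 0 k \is Num.real by move/mxOverP: dreal.
case: (@real_arg_maxP C 'I_n i0 predT (fun k => d 0 k) isT) => // k0 _ dmax.
set lam := d 0 k0 in dmax.
have {}dmax k : d 0 k <= lam by exact: dmax.
pose q (x : 'rV[C]_n) := (x *m A *m x^t*) 0 0.
pose nn (x : 'rV[C]_n) := (x *m x^t*) 0 0.
have trCM (x : 'rV[C]_n) : (x *m P^t*)^t* = P *m x^t*.
  by rewrite trmx_mul map_mxM /= trmxCK.
have nnE x : nn x = \sum_k `|(x *m P^t*) 0 k| ^+ 2.
  by rewrite -mulmx_trC_norm trCM mulmxA -(mulmxA x) PtP mulmx1.
have qE x : q x = \sum_k d 0 k * `|(x *m P^t*) 0 k| ^+ 2.
  by rewrite -mulmx_trC_diag trCM /q eA !mulmxA.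
pose w := row k0 P.
have wA : w *m A = lam *: w.
  by rewrite -row_mul eA !mulmxA PPt mul1mx row_mul row_diag_mx -scalemxAl -rowE.
have nnw : nn w = 1.
  rewrite /nn /w; transitivity ((P *m P^t*) k0 k0).
    by rewrite !mxE; apply: eq_bigr => k _; rewrite !mxE.
  by rewrite PPt mxE eqxx.
pose x : 'rV[C]_n := \row_k `|w 0 k|.
have nnx : nn x = 1.
  by rewrite -nnw /nn !mulmx_trC_norm; apply: eq_bigr => k _; rewrite mxE normr_id.
have qw : q w = lam by rewrite /q wA -scalemxAl mxE -/(nn w) nnw mulr1.
have qsum (u : 'rV[C]_n) : q u = \sum_j \sum_i u 0 i * A i j * (u 0 j)^*.
  by rewrite /q mxE; apply: eq_bigr => j _; rewrite !mxE mulr_suml.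
(* The chain is [lam <= |q w| <= q x]; the second inequality is the triangle inequality together
   with the nonnegativity of [A]. *)
have qx : lam <= q x.
  apply: le_trans (real_ler_norm _) _; first exact: dR.
  rewrite -qw !qsum; apply: le_trans (ler_norm_sum _ _ _) _.
  apply: ler_sum => j _; apply: le_trans (ler_norm_sum _ _ _) _.
  apply: ler_sum => i _; rewrite !mxE !normrM norm_conjC.
  by rewrite (ger0_norm (A_ge0 i j)) (conj_Creal (normr_real _)).
(* In spectral coordinates these nonnegative terms sum to [lam - q x], which is at most zero, so [x]
   only has components of eigenvalue [lam]. *)
have terms0 k : (lam - d 0 k) * `|(x *m P^t*) 0 k| ^+ 2 = 0.
  apply: (@psumr_eq0P _ _ predT (fun k => (lam - d 0 k) * `|(x *m P^t*) 0 k| ^+ 2)) => //.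
    by move=> i _; rewrite mulr_ge0 ?exprn_ge0 // subr_ge0 dmax.
  apply/eqP; rewrite eq_le; apply/andP; split; last first.
    by apply: sumr_ge0 => i _; rewrite mulr_ge0 ?exprn_ge0 // subr_ge0 dmax.
  under eq_bigr do rewrite mulrBl.
  by rewrite sumrB -mulr_sumr -nnE -qE nnx mulr1 subr_le0.
exists lam, x; split.
- by move=> i; rewrite mxE.
- apply/eqP => x0; move: nnx; rewrite x0 /nn mul0mx mxE => /eqP.
  by rewrite eq_sym oner_eq0.
- have -> : x *m A = x *m P^t* *m diag_mx d *m P by rewrite eA !mulmxA.
  have -> : x *m P^t* *m diag_mx d = lam *: (x *m P^t*).
    apply/rowP => k; rewrite mul_mx_diag [LHS]mxE [RHS]mxE mulrC.
    move/eqP: (terms0 k); rewrite mulf_eq0 expf_eq0 /= normr_eq0 subr_eq0.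
    by case/orP => [/eqP-> //|/eqP->]; rewrite !mulr0.
  by rewrite -scalemxAl -mulmxA PtP mulmx1.
Qed.

(** Zero extension from [D]. The equation is stated on [D] alone, because [K] may couple points
    outside [D] to points of [D]. *)
Lemma symmetric_nonneg_eigenfunction (T : finType) (D : {set T}) (x0 : T)
    (K : T -> T -> C) :
  x0 \in D -> (forall x y, K x y = K y x) -> (forall x y, 0 <= K x y) ->
  exists lam : C, exists g : T -> C,
    [/\ forall x, 0 <= g x, forall x, x \notin D -> g x = 0,
        exists x, g x != 0
      & forall x, x \in D -> \sum_(y in D) K x y * g y = lam * g x].
Proof.
move=> Dx0 symK K0.
pose A : 'M[C]_#|D| := \matrix_(i, j) K (enum_val i) (enum_val j).
have [] := @symmetric_nonneg_eigenvector _ A (enum_rank_in Dx0 x0).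
- by apply/matrixP => i j; rewrite !mxE.
- by move=> i j; rewrite mxE.
move=> lam [v [v0 vn0 vA]].
pose h := enum_rank_in Dx0.
exists lam, (fun x => if x \in D then v 0 (h x) else 0); split.
- by move=> x; case: ifP.
- by move=> x /negbTE->.
- have /rV0Pn [i vi] := vn0.
  by exists (enum_val i); rewrite enum_valP /h enum_valK_in.
- move=> x Dx; rewrite Dx big_enum_val /=.
  move/rowP: vA => /(_ (h x)); rewrite !mxE => <-.
  apply: eq_bigr => i _; rewrite enum_valP /h enum_valK_in mulrC mxE.
  by rewrite enum_rankK_in // symK.
Qed.

End Perron.

(** * Weighted hopping operators generated by involutive moves *)

Section Moves.
Variables (C : numClosedFieldType) (T : finType) (I : eqType).
Variables (ms : seq I) (wt : I -> C) (ok : I -> pred T) (tau : I -> T -> T).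
Hypothesis tauK : forall i, involutive (tau i).
Hypothesis ok_tau : forall i x, i \in ms -> ok i x -> ok i (tau i x).

(** The sum runs over moves and not over target points: two moves may join the same two points, as
    the two bonds of a ring of two sites do, and each of them counts. *)
Definition hop (v : T -> C) (x : T) : C :=
  \sum_(i <- ms | ok i x) wt i * v (tau i x).

Lemma ok_tauE i x : i \in ms -> ok i (tau i x) = ok i x.
Proof.
by move=> ims; apply/idP/idP => /(ok_tau ims) //; rewrite tauK.
Qed.

(** For each fixed move, reindexing by the involution [tau i] reverses all its edges. *)
Lemma sum_moves_sym (F : T -> T -> C) :
  \sum_x \sum_(i <- ms | ok i x) wt i * F x (tau i x) =
  \sum_x \sum_(i <- ms | ok i x) wt i * F (tau i x) x.
Proof.
have E (G : T -> T -> C) : \sum_x \sum_(i <- ms | ok i x) wt i * G x (tau i x) =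
    \sum_(i <- ms) \sum_(x | ok i x) wt i * G x (tau i x).
  under eq_bigr do rewrite big_mkcond.
  by rewrite exchange_big /=; apply: eq_bigr => i _; rewrite -big_mkcond.
rewrite E (E (fun x y => F y x)) !big_seq; apply: eq_bigr => i ims.
rewrite (reindex_onto (tau i) (tau i)) => [|x _]; last exact: tauK.
by apply: eq_big => x; rewrite ?tauK ?ok_tauE ?eqxx ?andbT.
Qed.

(* Ground state representation: dividing by a positive eigenvector turns the
   quadratic form of [lam - hop] into a sum of squares of differences. *)
Lemma dirichlet_form (g w u : T -> C) (lam mu : C) :
  (forall x, (g x)^* = g x) -> (forall x, w x = u x * g x) ->
  (forall x, hop g x = lam * g x) -> (forall x, hop w x = mu * w x) ->
  \sum_x \sum_(i <- ms | ok i x)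
     wt i * (g x * g (tau i x) * `|u x - u (tau i x)| ^+ 2) =
  2 * (lam - mu) * \sum_x `|w x| ^+ 2.
Proof.
move=> gR wE hg hw.
pose F1 x y := g x * g y * (u x * (u x)^*).
pose F2 x y := w x * (w y)^*.
have dec x y : g x * g y * `|u x - u y| ^+ 2 = F1 x y + F1 y x - (F2 x y + F2 y x).
  by rewrite normCK /F1 /F2 !wE !rmorphM rmorphB /= !gR; ring.
have S1 : \sum_x \sum_(i <- ms | ok i x) wt i * F1 x (tau i x) =
    lam * \sum_x `|w x| ^+ 2.
  rewrite mulr_sumr; apply: eq_bigr => x _.
  transitivity (g x * (u x * (u x)^*) * hop g x).
    rewrite mulr_sumr; apply: eq_bigr => i _; rewrite /F1.
    by ring.
  by rewrite hg normCK wE rmorphM /= gR; ring.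
have S2 : \sum_x \sum_(i <- ms | ok i x) wt i * F2 (tau i x) x =
    mu * \sum_x `|w x| ^+ 2.
  rewrite mulr_sumr; apply: eq_bigr => x _.
  rewrite normCK mulrA -hw mulr_suml; apply: eq_bigr => i _.
  by rewrite /F2 mulrA.
under eq_bigr do under eq_bigr do rewrite dec mulrBr !mulrDr.
under eq_bigr do rewrite sumrB !big_split /=.
rewrite sumrB !big_split /= -(sum_moves_sym F1) (sum_moves_sym F2) S1 S2.
by rewrite mulrBr mulrBl -!mulrA ![2 * _]mulr_natl !mulr2n.
Qed.

Hypothesis wt_gt0 : forall i, i \in ms -> 0 < wt i.

Lemma hop_eigenfunction (D : {set T}) x0 : x0 \in D ->
  (forall i x, i \in ms -> ok i x -> x \in D -> tau i x \in D) ->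
  exists lam : C, exists g : T -> C,
    [/\ forall x, 0 <= g x, forall x, x \notin D -> g x = 0,
        exists x, g x != 0 & forall x, hop g x = lam * g x].
Proof.
move=> Dx0 D_tau.
(* Moves with the same endpoints are merged into one kernel entry; the involutions make this kernel
   symmetric. *)
pose K x y : C := \sum_(i <- ms | ok i x && (tau i x == y)) wt i.
have [x y|x y|lam [g [g0 gD gn0 gE]]] := @symmetric_nonneg_eigenfunction C T D x0 K Dx0.
- rewrite /K [LHS]big_seq_cond [RHS]big_seq_cond; apply: eq_bigl => i.
  case ims: (i \in ms) => //=; apply/andP/andP => -[h /eqP<-];
    by rewrite ok_tauE // h tauK eqxx.
- by rewrite /K big_seq_cond sumr_ge0 // => i /andP[/wt_gt0/ltW].
exists lam, g; split=> // x; rewrite /hop.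
(* The complement of [D] is invariant too, since the moves are involutions; outside [D] both sides
   are therefore zero. *)
have [Dx|nDx] := boolP (x \in D); last first.
  rewrite gD // mulr0 big_seq_cond big1 // => i /andP[ims okx].
  rewrite gD ?mulr0 //; apply: contraNN nDx => Dt.
  by rewrite -(tauK i x); apply: D_tau => //; apply: ok_tau.
rewrite -gE // big_seq_cond.
under [in RHS]eq_bigr do rewrite /K mulr_suml.
rewrite (exchange_big_dep (fun i => ok i x)) /=; last by move=> y i _ /andP[].
rewrite [RHS]big_seq_cond; apply: eq_bigr => i /andP[ims okx].
rewrite (eq_bigl (pred1 (tau i x))) ?big_pred1_eq // => y /=.
rewrite okx /= eq_sym; have [->|] := eqVneq y (tau i x); last by rewrite andbF.
by rewrite D_tau.
Qed.

Variables (g : T -> C) (lam : C).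
Hypotheses (g_ge0 : forall x, 0 <= g x) (hop_g : forall x, hop g x = lam * g x).

(** At a zero of [g] the eigenvalue equation is a vanishing sum of nonnegative terms. Iterated along
    a path, zeros fill a whole connected component. *)
Lemma eigenfunction_zero_step i x : i \in ms -> ok i x -> g x = 0 -> g (tau i x) = 0.
Proof.
move=> ims okx gx0; have := hop_g x; rewrite gx0 mulr0 /hop big_seq_cond => /eqP.
rewrite psumr_eq0 => [/allP/(_ i ims)|j /andP[/wt_gt0/ltW wj _]]; last exact: mulr_ge0.
by rewrite ims okx /= mulf_eq0 gt_eqF ?wt_gt0 //= => /eqP.
Qed.

Variables (w u : T -> C) (mu : C).
Hypotheses (wE : forall x, w x = u x * g x) (hop_w : forall x, hop w x = mu * w x).

Let term_ge0 x i : i \in ms ->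
  0 <= wt i * (g x * g (tau i x) * `|u x - u (tau i x)| ^+ 2).
Proof. by move=> /wt_gt0/ltW wi; rewrite !mulr_ge0 ?exprn_ge0. Qed.

Let g_conj x : (g x)^* = g x.
Proof. by rewrite conj_Creal // ger0_real. Qed.

(** The left side of [dirichlet_form] is nonnegative and the squared norm is positive. In the order
    of [C] the conclusion also says that [lam - mu] is real. *)
Lemma eigenvalue_le_positive x : w x != 0 -> mu <= lam.
Proof.
move=> wx; have := dirichlet_form g_conj wE hop_g hop_w; set L := (X in X = _) => E.
have N0 : 0 < \sum_x `|w x| ^+ 2.
  rewrite (bigD1 x) //= ltr_pwDl ?exprn_gt0 ?normr_gt0 //.
  by apply: sumr_ge0 => y _; rewrite exprn_ge0.
have L0 : 0 <= L.
  by apply: sumr_ge0 => y _; rewrite big_seq_cond sumr_ge0 // => i /andP[]; auto.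
by move: L0; rewrite E -mulrA pmulr_rge0 ?ltr0n // pmulr_lge0 // subr_ge0.
Qed.

(** The equality case: the sum of squares is zero, so each difference of [u] along an edge with
    positive weight vanishes. *)
Lemma top_eigenfunction_step i x : mu = lam -> i \in ms -> ok i x ->
  g x != 0 -> g (tau i x) != 0 -> u x = u (tau i x).
Proof.
move=> Emu ims okx gx gy; have := dirichlet_form g_conj wE hop_g hop_w.
rewrite Emu subrr mulr0 mul0r => /psumr_eq0P H.
have F0 y : true -> 0 <= \sum_(i <- ms | ok i y)
     wt i * (g y * g (tau i y) * `|u y - u (tau i y)| ^+ 2).
  by rewrite big_seq_cond sumr_ge0 // => j /andP[]; auto.
have /eqP := H F0 x isT.
rewrite big_seq_cond psumr_eq0 => [/allP/(_ i ims)|j /andP[]]; last by auto.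
rewrite ims okx /= !mulf_eq0 (negbTE gx) (negbTE gy) gt_eqF ?wt_gt0 //=.
by rewrite orbb normr_eq0 subr_eq0 => /eqP.
Qed.

End Moves.

(** * The effective Hamiltonian as a sum of moves *)

(** Used to compute the rank of a mode in the enumeration of the product type. *)
Lemma index_allpairs_pair (T1 T2 : eqType) (s : seq T1) (r : seq T2) x y :
  x \in s -> y \in r ->
  index (x, y) [seq (a, b) | a <- s, b <- r] =
  (index x s * size r + index y r)%N.
Proof.
move=> + yr; elim: s => //= a s IHs; rewrite in_cons index_cat size_map.
have [->|neq_xa] /= := eqVneq x a => [_|xs].
  by rewrite map_f // index_map // => u v [].
have /negbTE-> : (x, y) \notin [seq (a, b) | b <- r].
  by apply/mapP => -[b _ [/eqP]]; rewrite (negbTE neq_xa).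
by rewrite IHs // mulSn addnA.
Qed.

Lemma enum_rank_index (T : finType) (x : T) :
  enum_rank x = index x (enum {: T}) :> nat.
Proof.
rewrite -[in RHS](nth_enum_rank x x) index_uniq ?enum_uniq //.
by rewrite -cardE; apply: ltn_ord.
Qed.

(** * Jordan-Wigner signs of hops without double occupancy *)

Section Fermions.
Variables (R : realType) (Ns : nat).
Local Notation C := R[i].
Local Notation site := (site Ns).
Local Notation mode := (mode Ns).
Local Notation vec := (vec R Ns).
Local Notation st := (st Ns).
Implicit Types (S Y : {set mode}) (x y z : site) (m : mode) (v w : vec).

Lemma vecD v w S : (v + w) S = v S + w S.
Proof. by rewrite !ffunE. Qed.

Lemma vecN v S : (- v) S = - v S.
Proof. by rewrite !ffunE. Qed.

Lemma vecZ (a : C) v S : (a *: v) S = a * v S.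
Proof. by rewrite !ffunE. Qed.

(** The enumeration of modes is lexicographic with the site first, so the sign [jw] counts electrons
    on lower sites whatever their spins. *)
Lemma ltn_enum_rank m m' : m.1 != m'.1 ->
  (enum_rank m < enum_rank m')%N = (m.1 < m'.1)%N.
Proof.
move: m m' => [x s] [y r] /= neq_xy.
have E z b : enum_rank (z, b) = (z * 2 + index b (enum {: bool}))%N :> nat.
  rewrite enum_rank_index.
  have -> : enum {: mode} = [seq (a, b) | a <- enum {: site}, b <- enum {: bool}].
    by rewrite !enumT [in LHS]unlock /= /prod_enum !enumT.
  rewrite index_allpairs_pair ?mem_enum // index_enum_ord.
  by rewrite -cardE card_bool.
rewrite !E.
have B b : (index b (enum {: bool}) < 2)%N by rewrite -card_bool cardE index_mem mem_enum.
by have := B s; have := B r; move: neq_xy; rewrite -val_eqE /=; lia.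
Qed.

Definition occ x S := ((x, true) \in S) || ((x, false) \in S).

Definition hardcore S := [forall x, ~~ (((x, true) \in S) && ((x, false) \in S))].

(** Transposing the full contents of two sites gives an involution; when one site is empty it moves
    the electron of the other with its spin. *)
Definition swap_sites x y S : {set mode} :=
  [set m | (tperm x y m.1, m.2) \in S].

Definition hc_supported v := forall S, ~~ hardcore S -> v S = 0.

Lemma occ_mem x s S : (x, s) \in S -> occ x S.
Proof. by rewrite /occ; case: s => ->; rewrite ?orbT. Qed.

Lemma hardcoreP S x s r : hardcore S -> (x, s) \in S -> (x, r) \in S -> s = r.
Proof. by move=> /forallP/(_ x); case: s r => [] [] // /negP H H1 H2; case: H; apply/andP. Qed.

Lemma not_hardcore S x : (x, true) \in S -> (x, false) \in S -> ~~ hardcore S.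
Proof.
by move=> h1 h2; apply/negP => hc; have := hardcoreP hc h1 h2.
Qed.

Lemma jw_sqr m S : jw R m S * jw R m S = 1.
Proof. by rewrite /jw -exprD addnn -mul2n exprM sqrrN expr1n expr1n. Qed.

Lemma jwD1 m S : jw R m (S :\ m) = jw R m S.
Proof.
rewrite /jw; congr (_ ^+ _); apply: eq_card => m'; rewrite !inE.
by have [->|] := eqVneq m' m; rewrite ?ltnn ?andbF.
Qed.

Lemma nopE m v S : nop m v S = if m \in S then v S else 0.
Proof.
rewrite /nop /cd /c !ffunE; case: ifP => // mS.
by rewrite setD11 setD1K // jwD1 mulrA jw_sqr mul1r.
Qed.

Lemma P0E v S : P0 v S = if hardcore S then v S else 0.
Proof.
have E (xs : seq site) : foldr (fun x w => w - nop (x, true) (nop (x, false) w)) v xs S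
    = if all (fun x => ~~ (((x, true) \in S) && ((x, false) \in S))) xs then v S else 0.
  elim: xs => //= x xs IH.
  by rewrite vecD vecN !nopE IH; case: ((x, true) \in S); case: ((x, false) \in S); rewrite /= ?subr0 ?subrr.
rewrite /P0 E; congr (if _ then _ else _).
apply/allP/forallP => [H x|H x _]; last exact: H.
by apply: H; rewrite mem_enum.
Qed.

(** [P0] multiplies by the indicator of [hardcore], so its range is a condition on the support and
    [w] is its own preimage. *)
Lemma inDomP Ne w :
  inDom Ns Ne w <-> (forall S, ~~ (hardcore S && (#|S| == Ne)) -> w S = 0).
Proof.
split=> [[v [hv ->]] S|H].
  by rewrite P0E; case: ifP => //= hS nS; apply: hv.
exists w; split=> [S nS|]; first by apply: H; rewrite negb_and nS orbT.
by apply/ffunP => S; rewrite P0E; case: ifP => // hS; apply: H; rewrite hS.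
Qed.

Definition below x Y := #|[set m in Y | (m.1 < x)%N]|.

Lemma jwE x s Y : ~~ occ x Y -> jw R (x, s) Y = (-1) ^+ below x Y.
Proof.
move=> nx; rewrite /jw /below; congr (_ ^+ _); apply: eq_card => m; rewrite !inE.
case mY: (m \in Y) => //=; apply: ltn_enum_rank => /=.
by apply: contraNneq nx => <-; apply: (@occ_mem _ m.2); case: m mY.
Qed.

(** The electrons that stay in place during a hop; the signs of annihilation and creation are both
    evaluated on this set. *)
Definition bystanders x y S := [set m in S | (m.1 != x) && (m.1 != y)].

Lemma occ_bystanders1 x y S : ~~ occ x (bystanders x y S).
Proof. by rewrite /occ !inE /= eqxx !andbF. Qed.

Lemma occ_bystanders2 x y S : ~~ occ y (bystanders x y S).
Proof. by rewrite /occ !inE /= eqxx !andbF. Qed.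

Lemma bystandersC x y S : bystanders x y S = bystanders y x S.
Proof. by apply/setP => m; rewrite !inE [(m.1 != x) && _]andbC. Qed.

Lemma bystandersE x y s S : hardcore S -> (x, s) \in S -> ~~ occ y S ->
  S :\ (x, s) = bystanders x y S.
Proof.
move=> hS xS ny; apply/setP => -[z r]; rewrite !inE /=.
case zS: ((z, r) \in S); rewrite ?andbF //= andbT.
have -> : z != y by apply: contraNneq ny => <-; apply: occ_mem zS.
rewrite andbT; congr (~~ _); apply/eqP/eqP => [[] //|zx].
by move: zS; rewrite zx => zS; rewrite (hardcoreP hS xS zS).
Qed.

Lemma swap_sitesE x y s S : hardcore S -> (x, s) \in S -> ~~ occ y S ->
  swap_sites x y S = (y, s) |: bystanders x y S.
Proof.
move=> hS xS ny; apply/setP => -[z r]; rewrite !inE /=.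
case: tpermP => [->|->|/eqP zx /eqP zy].
- rewrite eqxx andbF orbF [RHS](_ : _ = false).
    by apply: contraNF ny; apply: occ_mem.
  by apply/eqP => -[xy _]; move: ny; rewrite -xy (occ_mem xS).
- rewrite eqxx !andbF orbF; apply/idP/eqP => [h|[->] //].
  by rewrite (hardcoreP hS xS h).
- rewrite zx zy !andbT [(_, _) == _](_ : _ = false) //.
  by apply/eqP => -[zy' _]; rewrite zy' eqxx in zy.
Qed.

Lemma cd_cE x y s v S : x != y -> hardcore S -> hc_supported v ->
  cd (x, s) (c (y, s) v) S =
  if ((x, s) \in S) && ~~ occ y S then
    (-1) ^+ (below x (bystanders x y S) + below y (bystanders x y S)) *
    v (swap_sites x y S)
  else 0.
Proof.
move=> nxy hS hv; rewrite /cd /c !ffunE; case: ifP => //= xS; rewrite !inE.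
have -> : (y, s) == (x, s) = false.
  by apply/eqP => -[yx]; rewrite yx eqxx in nxy.
rewrite /=; case: ifP => [yS|yS]; first by rewrite (occ_mem yS) mulr0.
case: ifPn => [ny|].
  rewrite (swap_sitesE hS xS ny) -jwD1 !(bystandersE hS xS ny).
  by rewrite !jwE ?occ_bystanders1 ?occ_bystanders2 // exprD mulrA.
(* The target site holds an electron of the other spin, so [v] is evaluated at a doubly occupied
   set. *)
rewrite negbK => oy; rewrite hv ?mulr0 //.
have yS' : (y, ~~ s) \in S by move: oy yS; rewrite /occ; case: (s) => /= /orP[] ->.
have h1 : (y, s) \in (y, s) |: S :\ (x, s) by rewrite !inE eqxx.
have h2 : (y, ~~ s) \in (y, s) |: S :\ (x, s).
  rewrite !inE yS' andbT; apply/orP; right; apply/eqP => -[yx].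
  by rewrite yx eqxx in nxy.
by case: s {xS yS oy yS'} h1 h2 => /= h1 h2; [apply: not_hardcore h1 h2|apply: not_hardcore h2 h1].
Qed.

Lemma swap_sitesC x y S : swap_sites x y S = swap_sites y x S.
Proof. by apply/setP => m; rewrite !inE tpermC. Qed.

(** Of the four terms, over two spins and two directions, only the one that fits the electron
    present survives. *)
Lemma hop_pairE x y v S : x != y -> hardcore S -> hc_supported v ->
  (\sum_(s : bool) (cd (x, s) (c (y, s) v) + cd (y, s) (c (x, s) v))) S =
  if occ x S (+) occ y S then
    (-1) ^+ (below x (bystanders x y S) + below y (bystanders x y S)) *
    v (swap_sites x y S)
  else 0.
Proof.
move=> nxy hS hv; rewrite sum_ffunE big_bool /= !vecD !cd_cE // 1?eq_sym //.
rewrite ![bystanders y x S]bystandersC ![swap_sites y x S]swap_sitesC.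
rewrite [(below y _ + below x _)%N]addnC.
have nx : ~~ (((x, true) \in S) && ((x, false) \in S)) by move/forallP: hS.
have ny : ~~ (((y, true) \in S) && ((y, false) \in S)) by move/forallP: hS.
move: nx ny; rewrite /occ.
case: ((x, true) \in S); case: ((x, false) \in S) => //=;
case: ((y, true) \in S); case: ((y, false) \in S) => //= _ _;
by rewrite ?addr0 ?add0r.
Qed.

Lemma st_val k : (0 < Ns)%N -> st k = (k %% Ns)%N :> nat.
Proof.
by move=> N0; rewrite /st inordK // prednK // ltn_pmod.
Qed.

Lemma site_lt x : (0 < Ns)%N -> (x < Ns)%N.
Proof. by move=> N0; have := ltn_ord x; rewrite [in X in (_ < X)%N]prednK. Qed.

Lemma st_id x : (0 < Ns)%N -> st x = x.
Proof. by move=> N0; apply: val_inj; rewrite /= st_val // modn_small // site_lt. Qed.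

Lemma modnS_cases k : (0 < Ns)%N ->
  ((k %% Ns).+1 < Ns /\ k.+1 %% Ns = (k %% Ns).+1)%N \/
  ((k %% Ns).+1 = Ns /\ k.+1 %% Ns = 0)%N.
Proof.
move=> N0; have -> : (k.+1 %% Ns = (k %% Ns).+1 %% Ns)%N.
  by rewrite -addn1 -modnDml addn1.
have := ltn_pmod k N0; rewrite leq_eqVlt => /orP[/eqP E|E]; [right|left]; split=> //.
  by rewrite E modnn.
by rewrite modn_small.
Qed.

Lemma notin_site x Y m : ~~ occ x Y -> m \in Y -> (m.1 != x :> nat).
Proof.
by move=> nx mY; apply: contraNneq nx => /val_inj <-; apply: (@occ_mem _ m.2); case: m mY.
Qed.

(** Away from the seam the two counts are equal. Across it one count is all of [Y], an even number,
    and the other is zero. *)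
Lemma even_below_succ k Y : (0 < Ns)%N -> ~~ odd #|Y| ->
  ~~ occ (st k) Y -> ~~ occ (st k.+1) Y ->
  ~~ odd (below (st k) Y + below (st k.+1) Y).
Proof.
move=> N0 eY nx ny; rewrite /below !st_val //.
case: (modnS_cases k N0) => -[h ->].
  rewrite [X in (_ + X)%N](_ : _ = #|[set m in Y | (m.1 < k %% Ns)%N]|).
    by rewrite addnn odd_double.
  apply: eq_card => -[z r]; rewrite !inE /=; case mY: ((z, r) \in Y) => //=.
  by have /= := notin_site nx mY; rewrite st_val //; lia.
rewrite [X in (_ + X)%N](_ : _ = 0)%N ?addn0.
  rewrite [X in odd X](_ : _ = #|Y|) //.
  apply: eq_card => -[z r]; rewrite !inE /=; case mY: ((z, r) \in Y) => //=.
  by have /= := notin_site nx mY; have := site_lt z N0; rewrite st_val //; lia.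
by apply: eq_card0 => m; rewrite !inE andbF.
Qed.

Lemma odd_modn_even k : ~~ odd Ns -> odd (k %% Ns)%N = odd k.
Proof.
by move=> eN; rewrite [in RHS](divn_eq k Ns) oddD oddM (negbTE eN) andbF.
Qed.

(** Away from the seam the counts differ by the single electron in the middle. Across it they are
    [#|Y| - 1] and zero. *)
Lemma odd_below_succ2 k Y : (0 < Ns)%N -> ~~ odd Ns -> ~~ odd k -> ~~ odd #|Y| ->
  ~~ occ (st k) Y -> ~~ occ (st k.+2) Y ->
  #|[set m in Y | m.1 == st k.+1]| = 1%N ->
  odd (below (st k) Y + below (st k.+2) Y).
Proof.
move=> N0 eN ek eY nx ny one.
have ekN : ~~ odd (k %% Ns)%N by rewrite odd_modn_even.
(* An even residue is not the last one modulo the even [Ns], so the seam can only lie between [k.+1]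
   and [k.+2]. *)
have [h1 E1] : ((k %% Ns).+1 < Ns /\ k.+1 %% Ns = (k %% Ns).+1)%N.
  by case: (modnS_cases k N0) => // -[E _]; move: eN; rewrite -E /= (negbTE ekN).
rewrite /below !st_val //.
case: (modnS_cases k.+1 N0) => -[]; rewrite E1 => h ->.
  set A := [set m in Y | (m.1 < k %% Ns)%N].
  rewrite [X in (_ + X)%N](_ : _ = #|A| + 1)%N.
    by rewrite addnA addnn oddD odd_double.
  rewrite -one -cardsUI [X in (_ + X)%N](_ : _ = 0)%N.
    rewrite addn0; apply: eq_card => -[z r]; rewrite !inE /=; case mY: ((z, r) \in Y) => //=.
    rewrite -val_eqE /= st_val // E1.
    by have /= := notin_site nx mY; rewrite st_val //; lia.
  apply: eq_card0 => -[z r]; rewrite !inE /= -val_eqE /= st_val // E1.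
  by apply/negP; lia.
rewrite [X in (_ + X)%N](_ : _ = 0)%N ?addn0; last first.
  by apply: eq_card0 => m; rewrite !inE andbF.
move: eY; rewrite -(cardsID [set m | m.1 == st k.+1] Y).
rewrite [#|Y :&: _|](_ : _ = 1%N); last first.
  by rewrite -one; apply: eq_card => m; rewrite !inE.
rewrite oddD /= negbK [X in odd X -> _](_ : _ = #|[set m in Y | (m.1 < k %% Ns)%N]|) //.
apply: eq_card => -[z r]; rewrite !inE /=; case mY: ((z, r) \in Y); rewrite ?andbF //= andbT.
rewrite -val_eqE /= st_val // E1.
by have /= := notin_site nx mY; have := site_lt z N0; rewrite st_val //; lia.
Qed.

End Fermions.

(** * The projected Hamiltonian as minus a hopping operator with positive weights *)

Section Hamiltonian.
Variables (R : realType) (Ns : nat).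
Local Notation C := R[i].
Local Notation site := (site Ns).
Local Notation mode := (mode Ns).
Local Notation vec := (vec R Ns).
Local Notation st := (st Ns).
Implicit Types (S Y : {set mode}) (x y z : site) (v w : vec).

Lemma swap_sitesK x y : involutive (swap_sites x y).
Proof. by move=> S; apply/setP => -[z s]; rewrite !inE /= tpermK. Qed.

Lemma occ_swap x y z S : occ z (swap_sites x y S) = occ (tperm x y z) S.
Proof. by rewrite /occ !inE. Qed.

Lemma hardcore_swap x y S : hardcore (swap_sites x y S) = hardcore S.
Proof.
apply/forallP/forallP => H z; last by rewrite !inE.
by have := H (tperm x y z); rewrite !inE /= tpermK.
Qed.

Lemma card_swap x y S : #|swap_sites x y S| = #|S|.
Proof.
rewrite (_ : swap_sites x y S = (fun m : mode => (tperm x y m.1, m.2)) @^-1: S).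
  by apply: card_preimset => -[a r] [b s] [/perm_inj-> ->].
by apply/setP => m; rewrite !inE.
Qed.

Lemma card_bystanders x y S : hardcore S -> occ x S (+) occ y S ->
  #|S| = #|bystanders x y S|.+1.
Proof.
wlog: x y / occ x S => [H hS|ox hS].
  case ox: (occ x S) => //= oy; first by apply: H => //; rewrite ox (negbTE oy).
  by rewrite bystandersC; apply: H => //; rewrite oy ox.
rewrite ox /= => ny.
have [s xS] : exists s, (x, s) \in S by case/orP: ox; [exists true|exists false].
by rewrite (cardsD1 (x, s)) xS (bystandersE hS xS ny).
Qed.

Lemma card_bystanders_at x y z S : hardcore S -> occ z S -> z != x -> z != y ->
  #|[set m in bystanders x y S | m.1 == z]| = 1%N.
Proof.
move=> hS oz zx zy.
have [s zS] : exists s, (z, s) \in S by case/orP: oz; [exists true|exists false].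
rewrite -(cards1 (z, s)); apply: eq_card => -[u r]; rewrite !inE /= xpair_eqE.
have [->|] := eqVneq u z; rewrite ?andbF //= zx zy !andbT.
by apply/idP/eqP => [h|-> //]; rewrite (hardcoreP hS zS h).
Qed.

Lemma nsiteE z v S : hardcore S -> nsite z v S = if occ z S then v S else 0.
Proof.
move=> /forallP/(_ z) hS; rewrite /nsite vecD !nopE /occ.
by move: hS; case: ((z, true) \in S); case: ((z, false) \in S);
  rewrite ?addr0 ?add0r.
Qed.

Lemma hc_supported_nsite z v : hc_supported v -> hc_supported (nsite z v).
Proof. by move=> hv S hS; rewrite /nsite vecD !nopE !hv // !if_same addr0. Qed.

(* A move [(x, y, z)] exchanges an electron and a hole at [x] and [y]; in a
   correlated hop [z] is the site that has to be occupied. *)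
Definition move := (site * site * option site)%type.
Implicit Type m : move.

Definition moves : seq move :=
  [seq (st k, st k.+1, None) | k <- index_iota 1 Ns.+1] ++
  [seq (st j.*2, st j.*2.+2, Some (st j.*2.+1)) | j <- index_iota 1 (Ns./2).+1].

Definition move_wt (t t' : C) m := if m.2 is Some _ then t' else t.

(** Requiring [hardcore S] here lets [hop] account for the outer projection of [Heff]. *)
Definition move_ok m S :=
  [&& hardcore S, occ m.1.1 S (+) occ m.1.2 S &
      if m.2 is Some z then occ z S else true].

Definition move_swap m S := swap_sites m.1.1 m.1.2 S.

Hypotheses (N0 : (0 < Ns)%N) (eN : ~~ odd Ns).

(** As [Ns] is even, the parity of a label survives reduction modulo [Ns]. *)
Lemma st_neq k l : odd k != odd l -> st k != st l.
Proof.
apply: contraNneq => /(congr1 val) /=; rewrite !st_val // => E.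
by rewrite -(odd_modn_even k eN) -(odd_modn_even l eN) E.
Qed.

Lemma move_ok_swap m S : m \in moves -> move_ok m S -> move_ok m (move_swap m S).
Proof.
move=> mm; rewrite /move_ok /move_swap hardcore_swap !occ_swap tpermL tpermR.
case/and3P=> -> oxy /=; rewrite addbC oxy /=.
move: mm; rewrite mem_cat => /orP[] /mapP[k _ ->] //=.
by rewrite occ_swap tpermD // st_neq //= odd_double.
Qed.

Variable Ne : nat.
Hypothesis (oNe : odd Ne).

Lemma sum_nn_hop k w S : inDom Ns Ne w -> hardcore S ->
  (\sum_(s : bool) (cd (st k, s) (c (st k.+1, s) w) +
                    cd (st k.+1, s) (c (st k, s) w))) S =
  if move_ok (st k, st k.+1, None) S then
    w (move_swap (st k, st k.+1, None) S) else 0.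
Proof.
move=> /inDomP Dw hS.
have hw : hc_supported w by move=> S' h; apply: Dw; rewrite (negbTE h).
rewrite hop_pairE // ?st_neq //=; last by case: (odd k).
rewrite /move_ok hS /= andbT; case: ifP => // oxy.
have [cS|nS] := eqVneq #|S| Ne; last first.
  by rewrite !Dw ?mulr0 // negb_and card_swap nS orbT.
rewrite -signr_odd (negbTE (even_below_succ _ _ _ _)) ?mul1r //.
- by move: oNe; rewrite -cS (card_bystanders hS oxy).
- exact: occ_bystanders1.
- exact: occ_bystanders2.
Qed.

Lemma sum_nnn_hop k w S : ~~ odd k -> (Ne < Ns)%N -> inDom Ns Ne w -> hardcore S ->
  let m := (st k, st k.+2, Some (st k.+1)) in
  (\sum_(s : bool) (cd (st k, s) (c (st k.+2, s) (nsite (st k.+1) w)) +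
                    cd (st k.+2, s) (c (st k, s) (nsite (st k.+1) w)))) S =
  if move_ok m S then - w (move_swap m S) else 0.
Proof.
move=> ek NeNs /inDomP Dw hS /=.
have hw : hc_supported w by move=> S' h; apply: Dw; rewrite (negbTE h).
have hw' := hc_supported_nsite (st k.+1) hw.
have zx : st k.+1 != st k by rewrite st_neq //=; case: odd.
have zy : st k.+1 != st k.+2 by rewrite st_neq //=; case: odd.
(* The ends coincide only for [Ns = 2]. The term is then a product of occupation numbers of two
   sites, which vanishes because [Ne = 1]. *)
have [Exy|nxy] := eqVneq (st k) (st k.+2).
  rewrite /move_ok /= -Exy addbb /= andbF sum_ffunE big1 // => s _.
  have Ns2 : Ns = 2.
    move/(congr1 val): Exy; rewrite /= !st_val // => E.
    have nNs1 : Ns <> 1%N by move=> h; move: eN; rewrite h.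
    by case: (modnS_cases k N0) (modnS_cases k.+1 N0) => -[h1 h2] [] [h3 h4]; lia.
  have Ne1 : Ne = 1%N by move: oNe NeNs; rewrite Ns2; case: (Ne) => [|[|[]]].
  rewrite vecD -/(nop _ _) nopE nsiteE //.
  have [xS|_] := ifP; last by rewrite addr0.
  have [oz|_] := ifP; last by rewrite addr0.
  rewrite Dw ?addr0 // negb_and hS /= Ne1; apply/eqP => /eqP/cards1P[m0 Sm0].
  have [r zS] : exists r, (st k.+1, r) \in S by case/orP: oz; [exists true|exists false].
  move: xS zS; rewrite Sm0 !inE => /eqP<- /eqP[E _].
  by rewrite E eqxx in zx.
rewrite hop_pairE // /move_ok hS /=; case: ifP => //= oxy.
rewrite nsiteE ?hardcore_swap // occ_swap tpermD 1?eq_sym //.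
case: ifP => oz; last by rewrite mulr0.
have [cS|nS] := eqVneq #|S| Ne; last first.
  by rewrite !Dw ?mulr0 ?oppr0 // negb_and card_swap nS orbT.
rewrite -signr_odd odd_below_succ2 ?mulN1r //.
- by move: oNe; rewrite -cS (card_bystanders hS oxy).
- exact: occ_bystanders1.
- exact: occ_bystanders2.
- exact: card_bystanders_at.
Qed.

(** The coefficient [- t] meets the sign [+1] and the coefficient [t'] meets the sign [-1], so both
    kinds of hop have negative amplitude. *)
Lemma HeffE t t' w S : (Ne < Ns)%N -> inDom Ns Ne w ->
  Heff t t' w S = - hop moves (move_wt t t') move_ok move_swap w S.
Proof.
move=> NeNs Dw; rewrite /Heff P0E; case: ifP => hS; last first.
  by rewrite /hop big1 ?oppr0 // => m; rewrite /move_ok hS.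
have -> : P0 w = w.
  apply/ffunP => S'; rewrite P0E; case: ifP => // h.
  by move/inDomP: Dw => ->//; rewrite h.
rewrite /Hprime vecD !vecZ !sum_ffunE mulNr.
under eq_bigr do rewrite sum_nn_hop //.
rewrite [X in _ + _ * X](eq_bigr (fun j => if move_ok (st j.*2, st j.*2.+2, Some (st j.*2.+1)) S
   then - w (move_swap (st j.*2, st j.*2.+2, Some (st j.*2.+1)) S) else 0)); last first.
  by move=> j _; rewrite sum_nnn_hop // odd_double.
rewrite /hop big_cat /= !big_map opprD; congr (_ + _).
  by rewrite -big_mkcond mulr_sumr.
by rewrite -big_mkcond sumrN mulrN mulr_sumr.
Qed.

End Hamiltonian.

(** * Connectivity of the spin sectors *)

Section Connectivity.
Variable Ns : nat.
Hypotheses (N0 : (0 < Ns)%N) (eN : ~~ odd Ns).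
Local Notation site := (site Ns).
Local Notation mode := (mode Ns).
Local Notation st := (st Ns).
Local Open Scope nat_scope.
Implicit Types (S : {set mode}) (x y z : site) (w p q : seq (option bool)).
Implicit Type u : seq bool.

Definition step : rel {set mode} := fun S S' =>
  has (fun m => move_ok m S && (S' == move_swap m S)) (moves Ns).

Lemma step_sym : symmetric step.
Proof.
suff H S S' : step S S' -> step S' S by move=> S S'; apply/idP/idP; apply: H.
case/hasP => m mm /andP[okm /eqP->]; apply/hasP; exists m => //.
by rewrite move_ok_swap //= /move_swap swap_sitesK eqxx.
Qed.

Lemma step_connect_sym : connect_sym step.
Proof. exact: sym_connect_sym step_sym. Qed.

Lemma mem_moves_nn k : k < Ns -> (st k, st k.+1, None) \in moves Ns.
Proof.
move=> kN; rewrite mem_cat; apply/orP; left; apply/mapP.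
have st0 : st Ns = st 0 by apply: val_inj; rewrite /= !st_val // modnn mod0n.
have st1 : st Ns.+1 = st 1.
  by apply: val_inj; rewrite /= !st_val // -addn1 modnDl.
case: k kN => [|k] kN.
  (* Labels in the list run from 1 to [Ns], so the bond at 0 is listed under the label [Ns]. *)
  by exists Ns; rewrite ?mem_index_iota ?N0 ?ltnSn // st0 st1.
by exists k.+1; rewrite // mem_index_iota /= ltnS ltnW.
Qed.

Lemma mem_moves_nnn : (st 0, st 2, Some (st 1)) \in moves Ns.
Proof.
rewrite mem_cat; apply/orP; right; apply/mapP.
have stD k : st (Ns + k) = st k by apply: val_inj; rewrite /= !st_val // modnDl.
have hN : Ns./2.*2 = Ns by rewrite even_halfK.
have hN0 : 0 < Ns./2 by case: (Ns) N0 eN => [|[]].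
exists (Ns./2); first by rewrite mem_index_iota hN0 /=.
by rewrite hN -(stD 0) -(stD 1) -(stD 2) addn0 addn1 addn2.
Qed.

(** Words turn moves into rewriting rules: [Some b] is an electron of spin [b], [None] is a hole,
    and one letter per site excludes double occupancy. Position 0 is the site labelled [Ns]. *)
Definition cfg w : {set mode} := [set m : mode | nth None w m.1 == Some m.2].

Lemma hardcore_cfg w : hardcore (cfg w).
Proof. by apply/forallP => x; rewrite !inE /=; case: nth => [[]|]. Qed.

Lemma occ_cfg x w : occ x (cfg w) = isSome (nth None w x).
Proof. by rewrite /occ !inE /=; case: nth => [[]|]. Qed.

Lemma cfg_swap (i j : nat) w w' : i < Ns -> j < Ns ->
  nth None w' i = nth None w j -> nth None w' j = nth None w i ->
  (forall k, k != i -> k != j -> nth None w' k = nth None w k) ->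
  cfg w' = swap_sites (st i) (st j) (cfg w).
Proof.
move=> iN jN hi hj hk; apply/setP => -[z s]; rewrite !inE /=.
have vi : st i = i :> nat by rewrite st_val // modn_small.
have vj : st j = j :> nat by rewrite st_val // modn_small.
case: tpermP => [->|->|/eqP zi /eqP zj]; rewrite ?vi ?vj ?hi ?hj //.
by rewrite hk //; [move: zi|move: zj]; rewrite -val_eqE /= ?vi ?vj.
Qed.

Definition wconn w w' := connect step (cfg w) (cfg w').

Lemma wconnC w w' : wconn w w' = wconn w' w.
Proof. exact: step_connect_sym. Qed.

Lemma wconn_trans w2 w1 w3 : wconn w1 w2 -> wconn w2 w3 -> wconn w1 w3.
Proof. exact: connect_trans. Qed.

Lemma wconn_refl w : wconn w w.
Proof. exact: connect0. Qed.

Lemma wconn_nn (i : nat) w w' : let j := i.+1 %% Ns in i < Ns ->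
  isSome (nth None w i) (+) isSome (nth None w j) ->
  nth None w' i = nth None w j -> nth None w' j = nth None w i ->
  (forall k, k != i -> k != j -> nth None w' k = nth None w k) ->
  wconn w w'.
Proof.
move=> j iN oij hi hj hk; apply: connect1; apply/hasP.
have jN : j < Ns by rewrite ltn_pmod.
have stj : st j = st i.+1 by apply: val_inj; rewrite /= !st_val // modn_mod.
exists (st i, st i.+1, None); first exact: mem_moves_nn.
rewrite /move_ok /move_swap hardcore_cfg !occ_cfg /= andbT !st_val //.
by rewrite (modn_small iN) oij -stj -(cfg_swap iN jN hi hj hk) eqxx.
Qed.

Lemma wconn_adj p a b q : size (p ++ a :: b :: q) = Ns ->
  isSome a (+) isSome b -> wconn (p ++ a :: b :: q) (p ++ b :: a :: q).
Proof.
rewrite size_cat /= => sz oab.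
have ip : size p < Ns by lia.
have jE : (size p).+1 %% Ns = (size p).+1 by rewrite modn_small //; lia.
have nth0 a' b' : nth None (p ++ a' :: b' :: q) (size p) = a'.
  by rewrite nth_cat ltnn subnn.
have nth1 a' b' : nth None (p ++ a' :: b' :: q) (size p).+1 = b'.
  by rewrite nth_cat ltnNge leqnSn subSnn.
apply: (@wconn_nn (size p)); rewrite ?jE ?nth0 ?nth1 //.
move=> k ki kj; rewrite !nth_cat; case: ltnP => // pk.
by case E: (k - size p) => [|[|n]] //=; lia.
Qed.

Lemma wconn_boundary a r b : size (a :: rcons r b) = Ns ->
  isSome a (+) isSome b -> wconn (a :: rcons r b) (b :: rcons r a).
Proof.
rewrite /= size_rcons => sz oab.
have i0 : (size r).+1 < Ns by rewrite -sz.
have jE : (size r).+2 %% Ns = 0 by rewrite sz modnn.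
have nth1 a' : nth None (rcons r a') (size r) = a' by rewrite nth_rcons ltnn eqxx.
apply: (@wconn_nn (size r).+1); rewrite ?jE /= ?nth1 //.
  by rewrite addbC.
move=> [|k] //; rewrite eqSS /= => kr _.
by rewrite !nth_rcons; case: ltnP => // _; rewrite (negbTE kr).
Qed.

(** The correlated hop on the first three sites is the only one used; it interchanges two neighbours
    in the order of the spins, and rotations bring other pairs to this place. *)
Lemma wconn_exchange a b q : size (None :: Some a :: Some b :: q) = Ns ->
  wconn (None :: Some a :: Some b :: q) (Some b :: Some a :: None :: q).
Proof.
move=> /= sz; apply: connect1; apply/hasP.
exists (st 0, st 2, Some (st 1)); first exact: mem_moves_nnn.
have [h1 h2] : 1 < Ns /\ 2 < Ns by lia.
rewrite /move_ok /move_swap /= hardcore_cfg !occ_cfg !st_val // mod0n.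
rewrite !modn_small //=.
rewrite -(@cfg_swap 0 2 _ (Some b :: Some a :: None :: q)) ?eqxx //.
by move=> [|[|[]]].
Qed.

Lemma wconn_hole_right p u q : size (p ++ None :: map Some u ++ q) = Ns ->
  wconn (p ++ None :: map Some u ++ q) (p ++ map Some u ++ None :: q).
Proof.
elim: u p => [|a u IHu] p sz /=; first exact: wconn_refl.
apply: (wconn_trans (wconn_adj _ _)) => //.
have := IHu (rcons p (Some a)); rewrite !cat_rcons; apply.
by rewrite -sz !size_cat /= ?size_cat.
Qed.

Lemma wconn_holes_right p h u q : size (p ++ nseq h None ++ map Some u ++ q) = Ns ->
  wconn (p ++ nseq h None ++ map Some u ++ q) (p ++ map Some u ++ nseq h None ++ q).
Proof.
elim: h p q => [|h IHh] p q sz /=; first exact: wconn_refl.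
apply: (@wconn_trans (rcons p None ++ map Some u ++ nseq h None ++ q)).
  rewrite -cat_rcons; apply: IHh; rewrite -sz /= !size_cat size_rcons /= !size_cat.
  by rewrite !addnS.
rewrite cat_rcons; apply: wconn_hole_right.
by move: sz; rewrite /= !size_cat /= ?size_cat; lia.
Qed.

(** Holes drift to the right by nearest-neighbour hops, which leave the order of the electrons
    unchanged. *)
Lemma wconn_gather p w : size (p ++ w) = Ns ->
  wconn (p ++ w) (p ++ map Some (pmap id w) ++ nseq (count_mem None w) None).
Proof.
elim: w p => [|a w IHw] p sz /=; first exact: wconn_refl.
rewrite -cat_rcons; apply: (wconn_trans (IHw _ _)); first by rewrite cat_rcons.
rewrite cat_rcons; case: a sz => [b|] sz /=; first exact: wconn_refl.
apply: wconn_hole_right; rewrite -sz !size_cat /= ?size_cat size_map size_nseq.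
congr (_ + _.+1); rewrite size_pmap -(count_predC isSome w); congr (_ + _).
by apply: eq_count => -[].
Qed.

Definition canon u : seq (option bool) := map Some u ++ nseq (Ns - size u) None.

Lemma size_canon u : size u < Ns -> size (canon u) = Ns.
Proof. by move=> uN; rewrite size_cat size_map size_nseq subnKC // ltnW. Qed.

Lemma canonE u : size u < Ns ->
  canon u = map Some u ++ None :: nseq (Ns - size u).-1 None.
Proof. by move=> uN; rewrite /canon -[Ns - size u]prednK ?subn_gt0. Qed.

(** The first electron crosses the boundary into the last hole and moves left to the end of the
    word; the hole it left in front then passes through the whole word. *)
Lemma canon_rot1 a u : size (a :: u) < Ns -> wconn (canon (a :: u)) (canon (rcons u a)).
Proof.
move=> uN; have sz := size_canon uN; move: (sz); rewrite !canonE ?size_rcons //.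
set h := (Ns - _).-1; rewrite /= => sz'.
have nE : None :: nseq h None = rcons (nseq h (@None bool)) None.
  by elim: h {sz'} => //= h <-.
rewrite nE -rcons_cat.
apply: (wconn_trans (wconn_boundary _ _)) => //.
  by move: sz'; rewrite nE -rcons_cat.
rewrite -cats1 -!catA.
apply: (@wconn_trans (None :: map Some u ++ [:: Some a] ++ nseq h None)).
  have := @wconn_holes_right (None :: map Some u) h [:: a] [::].
  rewrite /= !cats0; apply.
  by move: sz'; rewrite /= !size_cat /= ?size_cat /=; lia.
have := @wconn_hole_right [::] (rcons u a) (nseq h None).
rewrite /= map_rcons !cat_rcons -nE; apply.
by move: sz'; rewrite /= !size_cat /= size_nseq; lia.
Qed.

(** One hole is carried to the front, the correlated hop exchanges the two spins, and the hole is
    carried back. *)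
Lemma canon_swap a b u : size (a :: b :: u) < Ns ->
  wconn (canon (a :: b :: u)) (canon (b :: a :: u)).
Proof.
move=> uN; have sz := size_canon uN; move: (sz); rewrite !canonE //.
set h := (Ns - _).-1 => sz'.
apply: (@wconn_trans (None :: map Some [:: a, b & u] ++ nseq h None)).
  rewrite wconnC; apply: (@wconn_hole_right [::] [:: a, b & u]).
  by move: sz'; rewrite /= !size_cat /=; lia.
rewrite /=; apply: (wconn_trans (wconn_exchange _)).
  by move: sz'; rewrite /= !size_cat /=; lia.
apply: (@wconn_hole_right [:: Some b; Some a] u).
by move: sz'; rewrite /= !size_cat /=; lia.
Qed.

Lemma canon_rot u1 u2 : size (u1 ++ u2) < Ns ->
  wconn (canon (u1 ++ u2)) (canon (u2 ++ u1)).
Proof.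
elim: u1 u2 => [|a u1 IH] u2 uN; first by rewrite cats0; apply: wconn_refl.
rewrite -cat_rcons; apply: (@wconn_trans (canon (u1 ++ rcons u2 a))).
  by rewrite -rcons_cat; apply: canon_rot1.
by apply: IH; rewrite size_cat size_rcons addnS -size_cat.
Qed.

(** Conjugation of the swap at the front by a rotation of the spin word. *)
Lemma canon_swap_in u1 a b u2 : size (u1 ++ a :: b :: u2) < Ns ->
  wconn (canon (u1 ++ a :: b :: u2)) (canon (u1 ++ b :: a :: u2)).
Proof.
move=> uN; apply: (wconn_trans (canon_rot uN)) => /=.
have uN' : size [:: a, b & u2 ++ u1] < Ns.
  by move: uN; rewrite /= !size_cat /=; lia.
apply: (wconn_trans (canon_swap uN')).
apply: (@canon_rot [:: b, a & u2] u1).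
by move: uN; rewrite /= !size_cat /=; lia.
Qed.

Lemma canon_false_right u1 i u2 : size (u1 ++ false :: nseq i true ++ u2) < Ns ->
  wconn (canon (u1 ++ false :: nseq i true ++ u2))
        (canon (u1 ++ nseq i true ++ false :: u2)).
Proof.
elim: i u1 => [|i IH] u1 uN /=; first exact: wconn_refl.
apply: (wconn_trans (canon_swap_in _)) => //.
have := IH (rcons u1 true); rewrite !cat_rcons; apply.
by move: uN; rewrite /= !size_cat /= ?size_cat; lia.
Qed.

(** Insertion sort by adjacent swaps: the tail is sorted first, then its new head passes the up
    spins if it is a down spin. *)
Lemma canon_sort u1 u : size (u1 ++ u) < Ns ->
  wconn (canon (u1 ++ u))
    (canon (u1 ++ nseq (count_mem true u) true ++ nseq (count_mem false u) false)).
Proof.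
elim: u u1 => [|a u IH] u1 uN /=; first exact: wconn_refl.
rewrite -cat_rcons; apply: (wconn_trans (IH _ _)); first by rewrite cat_rcons.
rewrite cat_rcons; case: a uN => uN /=; first exact: wconn_refl.
apply: canon_false_right; move: uN; rewrite !size_cat /= ?size_cat !size_nseq.
rewrite -(count_predC (pred1 true) u) (@eq_count _ (pred1 false) (predC (pred1 true))) //.
by case.
Qed.

Definition nspin b S := #|[set m in S | m.2 == b]|.

Lemma card_nspin S : #|S| = nspin true S + nspin false S.
Proof.
rewrite -(cardsID [set m | m.2 == true] S); congr (_ + _); apply: eq_card => -[x s].
  by rewrite !inE.
by rewrite !inE /=; case: s; rewrite ?andbF ?andbT.
Qed.

Lemma nspin_swap b x y S : nspin b (swap_sites x y S) = nspin b S.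
Proof.
rewrite /nspin -(card_swap x y [set m in S | m.2 == b]).
by apply: eq_card => m; rewrite !inE.
Qed.

Lemma nspin_connect b S S' : connect step S S' -> nspin b S = nspin b S'.
Proof.
case/connectP => p pth ->; elim: p S pth => //= S1 p IH S /andP[/hasP[m _]].
by case/andP => _ /eqP S1E /IH <-; rewrite S1E nspin_swap.
Qed.

Lemma nspin_cfg b w : size w = Ns -> nspin b (cfg w) = count_mem (Some b) w.
Proof.
move=> sz; rewrite -sum1_count (big_nth None) sz -[X in index_iota _ X](prednK N0).
rewrite big_mkord sum1dep_card /nspin.
rewrite -(card_imset [set i : site | nth None w i == Some b] (f := fun i => (i, b))).
  apply: eq_card => -[z s]; rewrite !inE /=; apply/andP/imsetP => [[/eqP h /eqP sb]|].
    by exists z; rewrite ?inE ?h -?sb.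
  by case=> i; rewrite inE => h [-> ->].
by move=> i j [].
Qed.

Definition word S : seq (option bool) :=
  mkseq (fun i => if (st i, true) \in S then Some true
                  else if (st i, false) \in S then Some false else None) Ns.

Lemma word_cfg S : hardcore S -> cfg (word S) = S.
Proof.
move=> hS; apply/setP => -[z s]; rewrite !inE /= nth_mkseq ?site_lt // st_id //.
by move/forallP/(_ z): hS; case: s; case: ((z, true) \in S); case: ((z, false) \in S).
Qed.

Lemma nspin_canon b u : size u < Ns -> nspin b (cfg (canon u)) = count_mem b u.
Proof.
move=> uN; rewrite nspin_cfg ?size_canon // count_cat count_map count_nseq /= addn0.
by apply: eq_count => a.
Qed.

Definition sector_repr i j : {set mode} := cfg (canon (nseq i true ++ nseq j false)).

(** Gathering the holes and sorting the spin word reduces every configuration to a normal form fixed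
    by its two spin counts. *)
Lemma connect_sector_repr S : hardcore S -> #|S| < Ns ->
  connect step S (sector_repr (nspin true S) (nspin false S)).
Proof.
move=> hS SN; set w := word S.
have sz : size w = Ns by rewrite size_mkseq.
have := @wconn_gather [::] w sz; rewrite /=.
set u := pmap id w => H.
have szu : size u + count_mem None w = Ns.
  rewrite -sz size_pmap -[RHS](count_predC isSome w); congr (_ + _).
  by apply: eq_count => -[].
have cE : map Some u ++ nseq (count_mem None w) None = canon u.
  by rewrite /canon -[X in X - _]szu addKn.
have count_u : count_mem true u + count_mem false u = size u.
  rewrite -(count_predC (pred1 true) u); congr (_ + _).
  by apply: eq_count => -[].
rewrite cE /wconn word_cfg // in H.
have nS b : nspin b S = count_mem b u.
  rewrite (nspin_connect b H) nspin_cfg.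
    rewrite count_cat count_map count_nseq /= addn0.
    by apply: eq_count => a.
  by rewrite -cE size_cat size_map size_nseq.
have uN : size u < Ns by rewrite -count_u -!nS -card_nspin.
apply: connect_trans H _; rewrite !nS.
exact: (@canon_sort [::] u uN).
Qed.

Lemma connect_sector S S' : hardcore S -> hardcore S' -> #|S| < Ns -> #|S| = #|S'| ->
  nspin true S = nspin true S' -> connect step S S'.
Proof.
move=> hS hS' SN ES EnS.
have Ef : nspin false S = nspin false S'.
  by apply/eqP; rewrite -(eqn_add2l (nspin true S)) {2}EnS -!card_nspin ES.
apply: connect_trans (connect_sector_repr hS SN) _.
by rewrite step_connect_sym EnS Ef; apply: connect_sector_repr; rewrite -?ES.
Qed.

Lemma sector_reprP i j : i + j < Ns ->
  [/\ hardcore (sector_repr i j), #|sector_repr i j| = i + j &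
      nspin true (sector_repr i j) = i].
Proof.
move=> ijN; have sz : size (nseq i true ++ nseq j false) < Ns.
  by rewrite size_cat !size_nseq.
split; first exact: hardcore_cfg.
  by rewrite card_nspin !nspin_canon // !count_cat !count_nseq /= !mul1n !mul0n addn0.
by rewrite nspin_canon // count_cat !count_nseq /= mul1n mul0n addn0.
Qed.

End Connectivity.

(** * Total spin *)

(** Total spin with one-particle matrix [p], acting on amplitudes that depend only on the number [n]
    of up spins among [N]. The default [0.-1 = 0] is harmless, as its coefficient is zero. *)
Definition ladder_act (F : numFieldType) (N : F) (p : bool -> bool -> F)
    (a : nat -> F) (n : nat) : F :=
  2^-1 * (n%:R * (p true true * a n + p true false * a n.-1) +
          (N - n%:R) * (p false true * a n.+1 + p false false * a n)).

(** The Casimir operator is the scalar of spin [N / 2]; [j] plays the part of the imaginary unit in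
    the second Pauli matrix. *)
Lemma ladder_casimir (F : numFieldType) (N j : F) (a : nat -> F) (n : nat) :
  j * j = -1 ->
  let sx (s u : bool) := if s != u then 1 else 0 in
  let sy (s u : bool) := if s == u then 0 else if s then - j else j in
  let sz (s u : bool) := if s == u then (if s then 1 else -1) else 0 in
  ladder_act N sx (ladder_act N sx a) n + ladder_act N sy (ladder_act N sy a) n
  + ladder_act N sz (ladder_act N sz a) n = N / 2 * (N / 2 + 1) * a n.
Proof.
move=> j2 /=; rewrite /ladder_act /=; case: n => [|n] /=.
  by field: j2.
by field: j2.
Qed.

Section Spin.
Variables (R : realType) (Ns Ne : nat).
Local Notation C := R[i].
Local Notation site := (site Ns).
Local Notation mode := (mode Ns).
Local Notation vec := (vec R Ns).
Implicit Types (S : {set mode}) (x y : site) (v w : vec) (a : nat -> C).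

Definition in_sector S := hardcore S && (#|S| == Ne).

Definition flip x s S : {set mode} := (x, ~~ s) |: S :\ (x, s).

(** Both Jordan-Wigner signs are taken with [x] empty and equal the same power of -1, so they
    cancel. *)
Lemma cd_c_flip x s v S :
  cd (x, s) (c (x, ~~ s) v) S =
  if ((x, s) \in S) && ((x, ~~ s) \notin S) then v (flip x s S) else 0.
Proof.
rewrite /cd /c !ffunE; case: ifP => //= xS; rewrite !inE.
have -> : (x, ~~ s) != (x, s) by rewrite xpair_eqE eqxx /=; case: (s).
case nS: ((x, ~~ s) \in S) => /=; first by rewrite mulr0.
have nx : ~~ occ x (S :\ (x, s)).
  by move: nS; rewrite /occ !inE !xpair_eqE eqxx; case: (s) => /= ->.
by rewrite -jwD1 mulrA !jwE // -signr_odd -expr2 sqrr_sign mul1r.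
Qed.

Section Flip.
Variables (S : {set mode}) (x : site) (s : bool).
Hypotheses (xS : (x, s) \in S) (nxS : (x, ~~ s) \notin S).

Lemma mem_flip y r :
  ((y, r) \in flip x s S) = if y == x then r == ~~ s else (y, r) \in S.
Proof.
rewrite !inE !xpair_eqE; have [->|] //= := eqVneq y x.
by move: xS nxS; case: (s); case: (r) => /= h /negbTE h'; rewrite ?h ?h'.
Qed.

Lemma occ_flip y : occ y (flip x s S) = occ y S.
Proof.
rewrite /occ !mem_flip; have [->|//] := eqVneq y x.
by case: (s) xS => ->; rewrite ?orbT.
Qed.

Lemma hardcore_flip : hardcore (flip x s S) = hardcore S.
Proof.
apply: eq_forallb => y; rewrite !mem_flip; have [->|//] := eqVneq y x.
by move: nxS; case: (s) xS => /= -> /negbTE->.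
Qed.

Lemma card_flip : #|flip x s S| = #|S|.
Proof.
by rewrite cardsU1 !inE (negbTE nxS) andbF /= [in RHS](cardsD1 (x, s)) xS.
Qed.

Lemma in_sector_flip : in_sector (flip x s S) = in_sector S.
Proof. by rewrite /in_sector hardcore_flip card_flip. Qed.

Lemma nspin_flip : nspin true (flip x s S) =
  if s then (nspin true S).-1 else (nspin true S).+1.
Proof.
rewrite /nspin; case: s xS nxS => /= hs ns.
  rewrite [in RHS](cardsD1 (x, true)) !inE hs /=; apply: eq_card => -[y r].
  by rewrite !inE !xpair_eqE; case: (y == x); case: r => //=; rewrite ?andbF.
rewrite (cardsD1 (x, true)) !inE eqxx /= add1n; congr _.+1; apply: eq_card => -[y r].
rewrite !inE !xpair_eqE; have [->|] := eqVneq y x; case: r => //=; rewrite ?andbF ?andbT //.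
by rewrite (negbTE ns).
Qed.

End Flip.

Lemma card_spin_at s S : #|[set x : site | (x, s) \in S]| = nspin s S.
Proof.
rewrite -(card_imset _ (f := fun i => (i, s))); last by move=> i j [].
rewrite /nspin; apply: eq_card => -[z r]; rewrite !inE /=.
apply/imsetP/andP => [[j]|[h /eqP rs]]; first by rewrite inE => h [-> ->].
by exists z; rewrite ?inE -rs.
Qed.

Lemma sum_spin_at s S (k : C) :
  \sum_(x : site | (x, s) \in S) k = (nspin s S)%:R * k.
Proof.
rewrite sumr_const mulr_natl -card_spin_at; congr (_ *+ _).
by apply: eq_card => x; rewrite inE.
Qed.

Variable G : {set mode} -> C.
Hypothesis G_out : forall S, ~~ in_sector S -> G S = 0.
Hypothesis G_flip : forall x s S, (x, s) \in S -> (x, ~~ s) \notin S ->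
  G (flip x s S) = G S.

(** The general form of a ground state, with [a] as coordinates; only [a 0] up to [a Ne] matter. *)
Definition profile a : vec := [ffun S => G S * a (nspin true S)].

Lemma profile_out a S : ~~ in_sector S -> profile a S = 0.
Proof. by move=> nS; rewrite ffunE G_out // mul0r. Qed.

Definition shift (s u : bool) n := if s == u then n else if s then n.-1 else n.+1.

Lemma cd_c_profile x s u a S :
  cd (x, s) (c (x, u) (profile a)) S =
  if (x, s) \in S then G S * a (shift s u (nspin true S)) else 0.
Proof.
have [->|] := eqVneq s u; first by rewrite -/(nop _ _) nopE /shift eqxx ffunE.
move=> nsu; have -> : u = ~~ s by case: s u nsu => [] [].
rewrite cd_c_flip; case xS: ((x, s) \in S) => //=.
case: ifPn => [nxS|].
  by rewrite ffunE G_flip // (nspin_flip xS nxS) /shift; case: (s).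
rewrite negbK => xS'; rewrite G_out ?mul0r // negb_and.
by case: s xS xS' {nsu} => /= h1 h2; [rewrite (not_hardcore h1 h2)|rewrite (not_hardcore h2 h1)].
Qed.

Definition spin_act (k : 'I_3) : (nat -> C) -> nat -> C :=
  ladder_act Ne%:R (pauli R k).

Lemma nspin_false S : in_sector S -> (nspin false S)%:R = Ne%:R - (nspin true S)%:R :> C.
Proof.
by case/andP => _ /eqP <-; rewrite card_nspin natrD addrC addKr.
Qed.

(** Since [G] ignores spins it factors out, and the sum over sites contributes the numbers of up and
    down electrons. *)
Lemma Stot_profile k a : Stot k (profile a) = profile (spin_act k a).
Proof.
apply/ffunP => S; rewrite /Stot vecZ sum_ffunE.
have [DS|nS] := boolP (in_sector S); last first.
  rewrite profile_out // big1 ?mulr0 // => x _.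
  rewrite sum_ffunE big1 // => s _; rewrite sum_ffunE big1 // => u _.
  by rewrite vecZ cd_c_profile G_out // mul0r if_same mulr0.
pose n := nspin true S.
pose K s := \sum_(u : bool) pauli R k s u * (G S * a (shift s u n)).
have E x : (\sum_(s : bool) \sum_(u : bool)
      pauli R k s u *: cd (x, s) (c (x, u) (profile a))) S =
    \sum_(s : bool) if (x, s) \in S then K s else 0.
  rewrite sum_ffunE; apply: eq_bigr => s _; rewrite sum_ffunE /K.
  under eq_bigr do rewrite vecZ cd_c_profile.
  by case: ifP => // _; rewrite big1 // => u _; rewrite mulr0.
under eq_bigr do rewrite E.
rewrite exchange_big big_bool /= -!big_mkcond /= !sum_spin_at.
rewrite nspin_false // /K !big_bool /= /shift /= ffunE /spin_act /ladder_act -/n.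
by ring.
Qed.

Lemma profile_eq a b : (forall n, (n <= Ne)%N -> a n = b n) -> profile a = profile b.
Proof.
move=> ab; apply/ffunP => S; have [DS|nS] := boolP (in_sector S); last first.
  by rewrite !profile_out.
rewrite !ffunE ab //; case/andP: DS => _ /eqP <-; rewrite card_nspin; exact: leq_addr.
Qed.

Lemma profile_total_spin a : has_total_spin Ns (Ne%:R / 2) (profile a).
Proof.
rewrite /has_total_spin /Stot2.
under eq_bigr do rewrite !Stot_profile.
have -> : (Ne%:R / 2 * (Ne%:R / 2 + 1)) *: profile a =
   profile (fun n => (Ne%:R / 2 * (Ne%:R / 2 + 1)) * a n).
  by apply/ffunP => S; rewrite vecZ !ffunE mulrCA.
have -> : \sum_(k < 3) profile (spin_act k (spin_act k a)) =
   profile (fun n => \sum_(k < 3) spin_act k (spin_act k a) n).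
  by apply/ffunP => S; rewrite sum_ffunE ffunE mulr_sumr; apply: eq_bigr => k _; rewrite ffunE.
apply: profile_eq => n _; rewrite !big_ord_recl big_ord0 addr0 addrA.
by apply: ladder_casimir; rewrite -expr2 sqrCi.
Qed.

End Spin.

(** * Ground states *)

Section GroundStates.
Variables (R : realType) (Ns Ne : nat) (t t' : R[i]).
Local Notation C := R[i].
Local Notation site := (site Ns).
Local Notation mode := (mode Ns).
Local Notation vec := (vec R Ns).
Local Notation moves := (moves Ns).
Hypotheses (eN : ~~ odd Ns) (NeNs : (Ne < Ns)%N).
Hypotheses (t_gt0 : 0 < t) (t'_gt0 : 0 < t').
Implicit Types (S : {set mode}) (x y : site) (v w : vec) (X : {set site}).
Local Notation hopH := (hop moves (move_wt t t') (@move_ok Ns) (@move_swap Ns)).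

Let N0 : (0 < Ns)%N.
Proof. exact: leq_ltn_trans NeNs. Qed.

Let wt_gt0 (m : move Ns) : 0 < move_wt t t' m.
Proof. by rewrite /move_wt; case: m.2. Qed.

Definition pos S : {set site} := [set x | occ x S].

Definition pos_ok (m : move Ns) X :=
  ((m.1.1 \in X) (+) (m.1.2 \in X)) && (if m.2 is Some z then z \in X else true).

Definition pos_swap (m : move Ns) X : {set site} :=
  [set z | tperm m.1.1 m.1.2 z \in X].

Lemma pos_swapK m : involutive (pos_swap m).
Proof. by move=> X; apply/setP => z; rewrite !inE tpermK. Qed.

Lemma pos_ok_swap m X : m \in moves -> pos_ok m X -> pos_ok m (pos_swap m X).
Proof.
move=> mm /andP[oxy oz]; rewrite /pos_ok !inE tpermL tpermR addbC oxy /=.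
move: mm oz; rewrite mem_cat => /orP[] /mapP[k _ ->] //=.
by rewrite inE tpermD // st_neq //= odd_double.
Qed.

Lemma card_pos_swap m X : #|pos_swap m X| = #|X|.
Proof.
rewrite (_ : pos_swap m X = tperm m.1.1 m.1.2 @^-1: X).
  by apply: card_preimset; apply: perm_inj.
by apply/setP => z; rewrite !inE.
Qed.

Lemma pos_move_swap m S : pos (move_swap m S) = pos_swap m (pos S).
Proof. by apply/setP => z; rewrite !inE occ_swap. Qed.

Lemma move_ok_pos m S : hardcore S -> move_ok m S = pos_ok m (pos S).
Proof.
move=> hS; rewrite /move_ok /pos_ok hS !inE /=; congr (_ && _).
by case: m.2 => // z; rewrite inE.
Qed.

Lemma card_pos S : hardcore S -> #|pos S| = #|S|.
Proof.
move=> hS; rewrite -(@card_in_imset _ _ (fun m : mode => m.1) (mem S)).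
  apply: eq_card => x; rewrite inE; apply/idP/imsetP => [/orP[] h|[[y s] h /= ->]].
  - by exists (x, true).
  - by exists (x, false).
  - exact: occ_mem h.
by move=> [x s] [y r] /= hx hy xy; move: hy; rewrite -xy => /(hardcoreP hS hx) ->.
Qed.

Lemma in_sector_swap m S : in_sector Ne (move_swap m S) = in_sector Ne S.
Proof. by rewrite /in_sector hardcore_swap card_swap. Qed.

(** Lifts a set of positions to the fully polarized sector, so that connectivity of configurations
    yields connectivity of position sets. *)
Definition polarized X : {set mode} := [set m | (m.1 \in X) && m.2].

Lemma hardcore_polarized X : hardcore (polarized X).
Proof. by apply/forallP => x; rewrite !inE /= andbF andbF. Qed.

Lemma pos_polarized X : pos (polarized X) = X.
Proof. by apply/setP => x; rewrite inE /occ !inE /= andbT andbF orbF. Qed.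

Lemma nspin_polarized X : nspin true (polarized X) = #|X|.
Proof.
rewrite -[in RHS](pos_polarized X) card_pos ?hardcore_polarized //.
by rewrite card_nspin [nspin false _]eq_card0 ?addn0 // => -[x []]; rewrite !inE /= ?andbF.
Qed.

(** Solving the problem on position sets and pulling back along [pos] makes [G] blind to spins by
    construction. *)
Lemma positive_eigenfunction : exists lam : C, exists G : {set mode} -> C,
  [/\ forall S, ~~ in_sector Ne S -> G S = 0,
      forall S, in_sector Ne S -> 0 < G S,
      forall x s S, (x, s) \in S -> (x, ~~ s) \notin S -> G (flip x s S) = G S
    & forall S, hopH G S = lam * G S].
Proof.
have [sR cR _] := @sector_reprP Ns N0 Ne 0 ltac:(by rewrite addn0).
rewrite addn0 in cR.
pose D0 := [set X : {set site} | #|X| == Ne].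
have D0x : pos (sector_repr Ns Ne 0) \in D0 by rewrite inE card_pos // cR.
have [i X im _|lam [g [g0 gD [X gX] gE]]] :=
  @hop_eigenfunction C _ _ moves (move_wt t t') pos_ok pos_swap pos_swapK
    pos_ok_swap (fun i _ => wt_gt0 i) D0 _ D0x.
  by rewrite !inE card_pos_swap.
pose G S := if in_sector Ne S then g (pos S) else 0.
have GE S : hopH G S = lam * G S.
  rewrite /G; case: ifPn => DS; last first.
    by rewrite mulr0 /hop big1 // => m _; rewrite in_sector_swap (negbTE DS) mulr0.
  have /andP[hS _] := DS.
  rewrite -gE /hop; apply: eq_big => m; first exact: move_ok_pos.
  by rewrite in_sector_swap DS pos_move_swap.
have G0 S : 0 <= G S by rewrite /G; case: ifP.
exists lam, G; split=> //.
- by move=> S /negbTE nS; rewrite /G nS.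
(* A zero at [S] is also one at the polarized set over the same positions; from there it would
   spread to the polarized set over [X], where [g X] is nonzero. *)
- move=> S DS; rewrite lt_def G0 andbT; apply/eqP => GS0.
  have /andP[hS /eqP cS] := DS.
  have cX : #|X| = Ne.
    by apply/eqP; apply: contraNT gX => nX; rewrite gD ?inE.
  have Dpol (Y : {set site}) : #|Y| = Ne -> in_sector Ne (polarized Y).
    by move=> cY; rewrite /in_sector hardcore_polarized -card_pos ?hardcore_polarized // pos_polarized cY eqxx.
  have cP : #|pos S| = Ne by rewrite card_pos.
  have conn : connect (@step Ns) (polarized (pos S)) (polarized X).
    have /andP[h1 /eqP c1] := Dpol _ cP; have /andP[h2 /eqP c2] := Dpol _ cX.
    by apply: connect_sector => //; rewrite ?c1 ?c2 // !nspin_polarized cP cX.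
  have GP : G (polarized (pos S)) = 0.
    by move: GS0; rewrite /G Dpol // DS pos_polarized.
  suff : G (polarized X) = 0 by rewrite /G Dpol // pos_polarized => /eqP; rewrite (negbTE gX).
  case/connectP: conn => p; elim: p (polarized (pos S)) GP => [|S2 p IH] S1 GS1 /=.
    by move=> _ ->.
  case/andP => /hasP[m mm /andP[okm /eqP ES2]]; apply: IH.
  rewrite ES2.
  by apply: (eigenfunction_zero_step _ G0 GE mm okm GS1).
- move=> x s S xS nxS; rewrite /G in_sector_flip //; congr (if _ then g _ else _).
  by apply/setP => y; rewrite !inE occ_flip.
Qed.

End GroundStates.

(** * Ground energy [- lam] and a basis of the ground space indexed by the number of up spins *)

Local Open Scope complex_scope.

Theorem mainTheorem10 (R : realType) (Ns Ne : nat) (t t' : R)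
  (hNs : ~~ odd Ns) (ht : 0 < t) (ht' : 0 < t')
  (hNe : odd Ne) (hNeNs : (Ne < Ns)%N) :
  let Smax : R[i] := (Ne%:R / 2)%:C in
  exists E0 : R[i],
    [/\ is_ground_energy Ns t%:C t'%:C Ne E0,
        has_dim Ns (ground_space Ns t%:C t'%:C Ne E0) (Ne.+1)
      & forall w, ground_space Ns t%:C t'%:C Ne E0 w ->
                  has_total_spin Ns Smax w].
Proof.
move=> Smax.
have SmaxE : Smax = Ne%:R / 2.
  by rewrite /Smax rmorphM fmorphV /= !rmorph_nat.
have t0 : 0 < t%:C by rewrite ltcR.
have t'0 : 0 < t'%:C by rewrite ltcR.
have N0 : (0 < Ns)%N := leq_ltn_trans (leq0n _) hNeNs.
have [lam [G [G_out G_gt0 G_flip GE]]] := positive_eigenfunction hNs hNeNs t0 t'0.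
pose hopH := hop (moves Ns) (move_wt t%:C t'%:C) (@move_ok Ns) (@move_swap Ns).
have wt0 m : m \in moves Ns -> 0 < move_wt t%:C t'%:C m.
  by rewrite /move_wt; case: m.2.
have G0 S : 0 <= G S.
  by have [/G_gt0/ltW//|/G_out->] := boolP (in_sector Ne S).
have GN0 S : in_sector Ne S -> G S != 0 by move/G_gt0/lt0r_neq0.
have msK m : involutive (@move_swap Ns m) by move=> S; apply: swap_sitesK.
have okS m S : m \in moves Ns -> move_ok m S -> move_ok m (move_swap m S).
  exact: move_ok_swap.
have domP (w : vec R Ns) : inDom Ns Ne w <-> forall S, ~~ in_sector Ne S -> w S = 0 by apply: inDomP.
have eigP w E : inDom Ns Ne w -> Heff t%:C t'%:C w = E *: w ->
    forall S, hopH w S = - E * w S.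
  move=> Dw H S; have := HeffE N0 hNs hNe t%:C t'%:C S hNeNs Dw.
  by rewrite H vecZ mulNr => ->; rewrite opprK.
have groundP a : ground_space Ns t%:C t'%:C Ne (- lam) (profile G a).
  have Dp : inDom Ns Ne (profile G a) by apply/domP => S nS; rewrite (profile_out G_out).
  split=> //; apply/ffunP => S; rewrite (HeffE N0 hNs hNe) // vecZ ffunE mulNr; congr (- _).
  rewrite mulrA -GE /hop mulr_suml; apply: eq_bigr => m _.
  by rewrite ffunE /move_swap nspin_swap mulrA.
(* One configuration per sector, at which the coordinates of a ground state are read off. *)
pose rep (n : nat) := sector_repr Ns n (Ne - n).
have repP n : (n <= Ne)%N -> in_sector Ne (rep n) /\ nspin true (rep n) = n.
  move=> nNe; have [] := @sector_reprP Ns N0 n (Ne - n); first by rewrite subnKC.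
  by rewrite /in_sector -/(rep n) => -> -> ->; rewrite subnKC // eqxx.
have nspin_le (S : {set mode Ns}) : in_sector Ne S -> (nspin true S <= Ne)%N.
  by case/andP => _ /eqP <-; rewrite card_nspin leq_addr.
have uE w : inDom Ns Ne w -> forall S, w S = w S / G S * G S.
  move=> /domP Dw S; have [DS|nS] := boolP (in_sector Ne S); last by rewrite Dw // !mul0r.
  by rewrite divfK // GN0.
(* The ratio [w / G] is constant along hops at the top eigenvalue, hence on each sector by
   connectivity. *)
have spanP w : ground_space Ns t%:C t'%:C Ne (- lam) w ->
    w = profile G (fun n => w (rep n) / G (rep n)).
  case=> Dw Hw; apply/ffunP => S; rewrite ffunE.
  have [DS|nS] := boolP (in_sector Ne S); last first.
    by rewrite G_out // mul0r; move/domP: Dw => ->.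
  rewrite [LHS](uE w Dw) [LHS]mulrC; congr (_ * _).
  have [Dr nr] := repP _ (nspin_le _ DS).
  have conn : connect (@step Ns) S (rep (nspin true S)).
    have /andP[h1 /eqP c1] := DS; have /andP[h2 /eqP c2] := Dr.
    by apply: connect_sector => //; rewrite ?c1 ?c2.
  case/connectP: conn => p; move: (rep _) => S' + ES'.
  elim: p S DS ES' {Dr nr} => [|S2 p IH] S1 DS1 /= ES'; first by rewrite ES'.
  case/andP => /hasP[m mm /andP[okm /eqP ES2]] pth.
  have DS2 : in_sector Ne S2 by rewrite ES2 in_sector_swap.
  rewrite -(IH S2) // ES2.
  have hw := eigP _ _ Dw Hw.
  apply: (top_eigenfunction_step msK okS wt0 G0 GE (uE w Dw) hw _ mm okm) => //.
  - by rewrite opprK.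
  - exact: GN0.
  - by rewrite -ES2 GN0.
exists (- lam); split.
- split.
    (* The witness is [G] itself as a vector. *)
    have [Dw Hw] := groundP (fun=> 1); exists (profile G (fun=> 1)); split=> //.
    have [D0 _] := repP 0 (leq0n _).
    apply/eqP => /ffunP/(_ (rep 0)); rewrite !ffunE mulr1 => /eqP.
    by rewrite (negbTE (GN0 _ D0)).
  move=> E [w [Dw wn0 Hw]]; rewrite lerNl.
  have [S wS] : exists S, w S != 0.
    apply/existsP; apply: contra_neqT wn0 => /existsPn wz.
    by apply/ffunP => S; rewrite ffunE; apply/eqP; rewrite -[_ == _]negbK wz.
  exact: (eigenvalue_le_positive msK okS wt0 G0 GE (uE w Dw) (eigP _ _ Dw Hw) wS).
(* The basis vectors are the restrictions of [G] to the sectors with [i] up spins; disjoint supports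
   give independence. *)
- exists (fun i : 'I_Ne.+1 => profile G (fun n => (n == i)%:R)); split.
  + by move=> i; apply: groundP.
  + move=> a /ffunP H i; have [Di ni] := repP i (ltn_ord i).
    have := H (rep i); rewrite sum_ffunE (bigD1 i) //= big1 => [|j ji].
      rewrite vecZ !ffunE ni eqxx mulr1 addr0 => /eqP.
      by rewrite mulf_eq0 (negbTE (GN0 _ Di)) orbF => /eqP.
    by rewrite vecZ ffunE ni val_eqE eq_sym (negbTE ji) !mulr0.
  + move=> w /spanP ->; pose a n := w (rep n) / G (rep n); exists (fun i => a i).
    apply/ffunP => S; rewrite sum_ffunE ffunE.
    have [DS|nS] := boolP (in_sector Ne S); last first.
      rewrite G_out // mul0r big1 // => i _.
      by rewrite vecZ ffunE G_out // mul0r mulr0.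
    have nN : (nspin true S < Ne.+1)%N by rewrite ltnS nspin_le.
    rewrite (bigD1 (Ordinal nN)) //= big1 => [|j ji].
      by rewrite vecZ ffunE /= eqxx mulr1 addr0 mulrC.
    rewrite vecZ ffunE [_ == _](_ : _ = false) ?mulr0 //.
    by apply: contra_neqF ji => /eqP E; apply: val_inj.
- by move=> w /spanP ->; rewrite SmaxE; apply: profile_total_spin.
Qed.
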